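(* Let $K$ be a positive integer and $C_\varepsilon\ge0$, and let $\{\beta_k\}$ and $\{\varepsilon_k\}$ be positive sequences with $\sum_{k=0}^{K-1}\beta_k\varepsilon_k\le\frac{C_\varepsilon}{2}$. Let $\{(x^k,z^k)\}_{k=0}^{K}$ be generated, with $z^0=0$, by the inexact augmented Lagrangian updates (see context) on the problem $\min_{x\in X}f_0(x)$ s.t. $f_i(x)\le0$, $i=1,\dots,m$, which is assumed to have a primal-dual solution $(x^*,z^* )$. Then for any $0\le k<K$, $$\big|f_0(x^{k+1})-f_0(x^* )\big|\le\varepsilon_k+\frac{2\|z^*\|+\sqrt{C_\varepsilon}}{\beta_k}\left(5\|z^*\|+\frac72\sqrt{C_\varepsilon}\right),$$ $$\big\|[f(x^{k+1})]_+\big\|\le\frac1{\beta_k}\left(5\|z^*\|+\frac72\sqrt{C_\varepsilon}\right).$$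
   Context: Setting: $X\subseteq\mathbb R^n$ is closed and convex; $f_0=g+h$ with $g$ convex differentiable and $h:\mathbb R^n\to\mathbb R\cup\{+\infty\}$ convex; $f_1,\dots,f_m$ are convex and differentiable; $\nabla g$ and $\nabla f_i$ are Lipschitz continuous on $\mathrm{dom}(h)\cap X$ with constants $L_0$ and $L_i$. $f(x)=(f_1(x),\dots,f_m(x))$, $[\cdot]_+$ is the componentwise positive part, $\|\cdot\|$ the Euclidean norm. Primal-dual solution $(x^*,z^* )$: a KKT point, i.e. $0\in\partial f_0(x^* )+N_X(x^* )+\sum_{i=1}^mz_i^*\nabla f_i(x^* )$ ($N_X$ the normal cone), $x^*\in X$, $z_i^*\ge0$, $f_i(x^* )\le0$, $z_i^*f_i(x^* )=0$ for all $i$. Augmented Lagrangian: $\mathcal L_\beta(x,z)=f_0(x)+\sum_{i=1}^m\psi_\beta(f_i(x),z_i)$, where $\psi_\beta(u,v)=uv+\frac\beta2u^2$ if $\beta u+v\ge0$ and $\psi_\beta(u,v)=-\frac{v^2}{2\beta}$ if $\beta u+v<0$. Inexact augmented Lagrangian updates: for $k=0,1,\dots$, $x^{k+1}\in X$ satisfies $\mathcal L_{\beta_k}(x^{k+1},z^k)\le\min_{x\in X}\mathcal L_{\beta_k}(x,z^k)+\varepsilon_k$ (such a point is assumed to exist), and $z^{k+1}=z^k+\beta_k\nabla_z\mathcal L_{\beta_k}(x^{k+1},z^k)$, i.e. $z_i^{k+1}=z_i^k+\beta_k\max\big(-\frac{z_i^k}{\beta_k},f_i(x^{k+1})\big)$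 for $i=1,\dots,m$. *)

(* Defs.v *)
From mathcomp Require Import all_boot all_order all_algebra.
From mathcomp Require Import all_classical all_reals all_analysis.

Set Implicit Arguments.
Unset Strict Implicit.
Unset Printing Implicit Defensive.

Import Order.TTheory GRing.Theory Num.Theory.
Import numFieldNormedType.Exports.

Local Open Scope classical_set_scope.
Local Open Scope ring_scope.

Section Euclidean.
Variables (R : realType) (n : nat).
Implicit Types u v x : 'rV[R]_n.

Definition dot u v : R := \sum_i u 0 i * v 0 i.

(* The library norm `|x| on row vectors is the sup norm, hence this one. *)
Definition enorm x : R := Num.sqrt (dot x x).

(* The vector of partial derivatives; it represents the differential 'd f x
   for [dot] only when f is differentiable at x, which is always assumed
   separately. *)
Definition grad (f : 'rV[R]_n -> R) x : 'rV[R]_n :=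
  \row_j 'D_(delta_mx 0 j) f x.

Definition lipschitz_grad_on (D : set 'rV[R]_n) (L : R) (f : 'rV[R]_n -> R) :=
  forall x y, D x -> D y -> enorm (grad f x - grad f y) <= L * enorm (x - y).

(* Meant for functions that never take the value -oo. The endpoints t = 0, 1
   are harmless because 0 * +oo = 0 in \bar R. *)
Definition econvex (h : 'rV[R]_n -> \bar R) :=
  forall (x y : 'rV[R]_n) (t : R), 0 <= t <= 1 ->
    (h (t *: x + (1 - t) *: y)%R <= t%:E * h x + (1 - t)%R%:E * h y)%E.

Definition edom (h : 'rV[R]_n -> \bar R) : set 'rV[R]_n :=
  [set x | (h x < +oo)%E].

(* Empty at points outside the effective domain. *)
Definition subdifferential (F : 'rV[R]_n -> \bar R) x : set 'rV[R]_n :=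
  [set s | edom F x /\ forall y : 'rV[R]_n, (F x + (dot s (y - x)%R)%:E <= F y)%E].

Definition normal_cone (X : set 'rV[R]_n) x : set 'rV[R]_n :=
  [set v | X x /\ forall y : 'rV[R]_n, X y -> dot v (y - x) <= 0].

End Euclidean.

Section ConvexProgram.
Variables (R : realType) (n m : nat).
Variables (X : set 'rV[R]_n) (g : 'rV[R]_n -> R) (h : 'rV[R]_n -> \bar R).
Variable f : 'I_m -> 'rV[R]_n -> R.

Definition objective (x : 'rV[R]_n) : \bar R := ((g x)%:E + h x)%E.

Definition pos_part (x : 'rV[R]_n) : 'rV[R]_m := \row_i Num.max (f i x) 0.

Definition primal_dual_solution (x : 'rV[R]_n) (z : 'rV[R]_m) :=
  [/\ exists s v, [/\ subdifferential objective x s, normal_cone X x v &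
        0 = s + v + \sum_i z 0 i *: grad (f i) x],
      X x,
      forall i, 0 <= z 0 i,
      forall i, f i x <= 0 &
      forall i, z 0 i * f i x = 0].

Definition psi (beta u v : R) : R :=
  if 0 <= beta * u + v then u * v + beta / 2 * u ^+ 2
  else - (v ^+ 2 / (2 * beta)).

Definition aug_lagrangian (beta : R) (x : 'rV[R]_n) (z : 'rV[R]_m) : \bar R :=
  (objective x + (\sum_i psi beta (f i x) (z 0 i))%R%:E)%E.

Definition inexact_primal_step (beta eps : R) (z : 'rV[R]_m) (x' : 'rV[R]_n) :=
  X x' /\ (aug_lagrangian beta x' z <=
    ereal_inf [set aug_lagrangian beta x z | x in X] + eps%:E)%E.

(* The displayed increment is beta times the gradient in z of the augmented
   Lagrangian: the partial derivative of psi beta u v in v is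
   max (- v / beta, u). *)
Definition dual_step (beta : R) (z : 'rV[R]_m) (x' : 'rV[R]_n) : 'rV[R]_m :=
  \row_i (z 0 i + beta * Num.max (- (z 0 i / beta)) (f i x')).

End ConvexProgram.

(* Main.v *)
(* With z' = [z + beta f(x)]_+ the multiplier after a step from (z, x), one has
   psi_beta(f_i(x), z_i) = (z'_i^2 - z_i^2) / (2 beta). Comparing x with the
   feasible point x^* in the inexact minimization gives
     f_0(x) + (|z'|^2 - |z|^2) / (2 beta) <= f_0(x^* ) + eps,
   while the KKT conditions and f(x) <= (z' - z) / beta give
     f_0(x^* ) <= f_0(x) + z^* . (z' - z) / beta.
   Adding the two, |z' - z^*|^2 <= |z - z^*|^2 + 2 beta eps, so every multiplier
   stays within |z^*| + sqrt C of z^*, hence |z| <= 2 |z^*| + sqrt C and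
   |z' - z| <= 2 |z^*| + 2 sqrt C. These bounds inserted in the two inequalities
   above, and in [f(x)]_+ <= |z' - z| / beta, give the claim. *)

Require Import Defs.
From mathcomp Require Import all_boot all_order all_algebra.
From mathcomp Require Import all_classical all_reals all_analysis.
From mathcomp Require Import ring lra.

Set Implicit Arguments.
Unset Strict Implicit.
Unset Printing Implicit Defensive.

Import Order.TTheory GRing.Theory Num.Theory.
Import numFieldNormedType.Exports.

Local Open Scope classical_set_scope.
Local Open Scope ring_scope.

(** * Euclidean inner product and norm on row vectors *)

Section Dot.
Variables (R : realType) (n : nat).
Implicit Types u v w : 'rV[R]_n.

Lemma dotC u v : dot u v = dot v u.
Proof. by apply: eq_bigr => i _; rewrite mulrC. Qed.

Lemma dotDl u v w : dot (u + v) w = dot u w + dot v w.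
Proof. by rewrite -big_split; apply: eq_bigr => i _; rewrite mxE mulrDl. Qed.

Lemma dotZl a u w : dot (a *: u) w = a * dot u w.
Proof. by rewrite mulr_sumr; apply: eq_bigr => i _; rewrite mxE mulrA. Qed.

Lemma dotNl u w : dot (- u) w = - dot u w.
Proof. by rewrite -scaleN1r dotZl mulN1r. Qed.

Lemma dotDr u v w : dot u (v + w) = dot u v + dot u w.
Proof. by rewrite dotC dotDl !(dotC u). Qed.

Lemma dotNr u v : dot u (- v) = - dot u v.
Proof. by rewrite dotC dotNl dotC. Qed.

Lemma dotZr a u v : dot u (a *: v) = a * dot u v.
Proof. by rewrite dotC dotZl dotC. Qed.

Lemma dot0l w : dot 0 w = 0.
Proof. by rewrite -(scale0r 0) dotZl mul0r. Qed.

Lemma dot_suml I (r : seq I) (F : I -> 'rV[R]_n) w :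
  dot (\sum_(i <- r) F i) w = \sum_(i <- r) dot (F i) w.
Proof.
by elim/big_rec2: _ => [|i y1 y2 _ <-]; rewrite ?dot0l ?dotDl.
Qed.

Lemma dot_ge0 u : 0 <= dot u u.
Proof. by apply: sumr_ge0 => i _; rewrite -expr2 sqr_ge0. Qed.

Lemma dot_eq0 u : (dot u u == 0) = (u == 0).
Proof.
apply/idP/eqP => [|->]; last by rewrite dot0l.
rewrite psumr_eq0 => [/allP u0|i _]; last by rewrite -expr2 sqr_ge0.
apply/rowP => i; apply/eqP.
by have := u0 i (mem_index_enum i); rewrite -expr2 sqrf_eq0 mxE.
Qed.

Lemma enorm_ge0 u : 0 <= enorm u.
Proof. exact: sqrtr_ge0. Qed.

Lemma sqr_enorm u : enorm u ^+ 2 = dot u u.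
Proof. by rewrite sqr_sqrtr ?dot_ge0. Qed.

Lemma enorm_eq0 u : (enorm u == 0) = (u == 0).
Proof. by rewrite -sqrf_eq0 sqr_enorm dot_eq0. Qed.

(** Cauchy-Schwarz, by expanding the squared norm of [enorm v *: u - enorm u *: v]. Zero norms are
    treated apart because [enorm u * enorm v] is cancelled at the end. *)
Lemma dot_le_enorm u v : dot u v <= enorm u * enorm v.
Proof.
have [/eqP|u0] := eqVneq (enorm u) 0.
  by rewrite enorm_eq0 => /eqP ->; rewrite dot0l mulr_ge0 ?enorm_ge0.
have [/eqP|v0] := eqVneq (enorm v) 0.
  by rewrite enorm_eq0 => /eqP ->; rewrite dotC dot0l mulr_ge0 ?enorm_ge0.
have uv0 : 0 < enorm u * enorm v by rewrite mulr_gt0// lt0r ?u0 ?v0 enorm_ge0.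
have := dot_ge0 (enorm v *: u - enorm u *: v).
rewrite !(dotDl, dotDr, dotNl, dotNr, dotZl, dotZr) -!sqr_enorm (dotC v u) => h.
rewrite -(ler_pM2l uv0); lra.
Qed.

Lemma enormD u v : enorm (u + v) <= enorm u + enorm v.
Proof.
rewrite -ler_sqr ?nnegrE ?addr_ge0 ?enorm_ge0//.
rewrite sqr_enorm !(dotDl, dotDr) (dotC v u) -!sqr_enorm sqrrD.
have := dot_le_enorm u v; lra.
Qed.

Lemma enormN u : enorm (- u) = enorm u.
Proof. by rewrite /enorm dotNl dotNr opprK. Qed.

Lemma enormZ a u : enorm (a *: u) = `|a| * enorm u.
Proof. by rewrite /enorm dotZl dotZr mulrA -expr2 sqrtrM ?sqr_ge0// sqrtr_sqr. Qed.

Lemma le_enorm u v : (forall i, `|u 0 i| <= `|v 0 i|) -> enorm u <= enorm v.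
Proof.
move=> uv; rewrite ler_wsqrtr//; apply: ler_sum => i _.
by rewrite -!expr2 -[leLHS]real_normK ?num_real// -[leRHS]real_normK ?num_real// ler_sqr.
Qed.

End Dot.

(** * First-order lower bound for convex functions *)

Section GradientInequality.
Variables (R : realType) (n : nat).

Lemma dot_grad (f : 'rV[R]_n -> R) x v :
  differentiable f x -> dot (grad f x) v = 'D_v f x.
Proof.
move=> fx; rewrite deriveE// {2}[v]row_sum_delta linear_sum /=.
by apply: eq_bigr => i _; rewrite linearZ mxE deriveE //= mulrC.
Qed.

(** By convexity, the difference quotient of [f] at [x] in direction [y - x] with step [t] in
    [(0, 1]] is at most [f y - f x]; letting [t] tend to 0 from the right gives the bound. *)
Lemma convex_function_grad (f : 'rV[R]_n -> R) x y :
  convex_function setT f -> differentiable f x ->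
  f x + dot (grad f x) (y - x) <= f y.
Proof.
move=> fconv fx; rewrite dot_grad// -lerBrDl.
have fdq := @diff_derivable _ _ _ _ _ (y - x) fx.
apply: (cvgr_to_le (cvg_dnbhs_at_right fdq)).
near=> t => /=.
have t0 : 0 < t by near: t; exact: nbhs_right_gt.
have t1 : t <= 1 by near: t; exact: nbhs_right_le.
have fle : f (t *: y + (1 - t) *: x) <= t * f y + (1 - t) * f x.
  by have := fconv (Itv01 (ltW t0) t1) y x; rewrite !in_setT; exact.
have -> : t *: (y - x) + x = t *: y + (1 - t) *: x.
  by rewrite scalerBr scalerBl scale1r addrA addrAC.
rewrite [leLHS]mulrC ler_pdivrMr//.
by move: fle; lra.
Unshelve. all: by end_near. Qed.

End GradientInequality.

(** * One iteration of the augmented Lagrangian method *)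

Section AugmentedLagrangian.
Variables (R : realType) (n m : nat).
Variables (X : set 'rV[R]_n) (g : 'rV[R]_n -> R) (h : 'rV[R]_n -> \bar R).
Variable f : 'I_m -> 'rV[R]_n -> R.
Implicit Types (x y : 'rV[R]_n) (z w : 'rV[R]_m) (beta eps : R).

(** Pair the stationarity equation with [y - xs]: the normal cone term is nonpositive, and the
    gradient inequality with complementary slackness bounds the constraint terms by
    [zs 0 i * f i y]. What remains bounds the subgradient term from below. *)
Lemma primal_dual_solution_saddle xs zs y :
  (forall i, convex_function setT (f i)) -> (forall i x, differentiable (f i) x) ->
  primal_dual_solution X g h f xs zs -> X y ->
  (objective g h xs <= objective g h y + (\sum_i zs 0 i * f i y)%:E)%E.
Proof.
move=> fconv fdiff [[s [v [[_ sF] [_ vX] sv0]]] _ zs_ge0 _ slack] Xy.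
have := congr1 (fun u => dot u (y - xs)) sv0; rewrite /= dot0l !dotDl dot_suml => sv.
have fi_grad : \sum_i dot (zs 0 i *: grad (f i) xs) (y - xs) <= \sum_i zs 0 i * f i y.
  apply: ler_sum => i _; rewrite dotZl.
  have := ler_wpM2l (zs_ge0 i) (convex_function_grad y (fconv i) (fdiff i xs)).
  by rewrite mulrDr slack add0r.
have s_ge : 0 <= dot s (y - xs) + \sum_i zs 0 i * f i y.
  by have := vX _ Xy; lra.
apply: le_trans (leeD2r _ (sF y)).
by rewrite -addeA leeDl// -EFinD lee_fin.
Qed.

(** Moving [beta] inside the maximum exhibits the update as a projection onto the nonnegative
    orthant. *)
Lemma dual_stepE beta z x i : 0 < beta ->
  dual_step f beta z x 0 i = Num.max 0 (z 0 i + beta * f i x).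
Proof.
move=> b0; rewrite mxE maxr_pMr ?ltW// addr_maxr mulrN mulrC divfK ?gt_eqF//.
by rewrite subrr.
Qed.

Lemma dual_step_ge0 beta z x i : 0 < beta -> 0 <= dual_step f beta z x 0 i.
Proof. by move=> b0; rewrite dual_stepE// le_max lexx. Qed.

(** The two branches of [psi] are the two cases of the projection: the new multiplier is
    [z 0 i + beta * f i x] in the first and 0 in the second. *)
Lemma psi_dual_step beta z x i : 0 < beta ->
  psi beta (f i x) (z 0 i) =
  (dual_step f beta z x 0 i ^+ 2 - z 0 i ^+ 2) / (2 * beta).
Proof.
move=> b0; have bn0 : beta != 0 by rewrite gt_eqF.
rewrite dual_stepE// /psi addrC; by case: leP => _; field; rewrite bn0.
Qed.

Lemma aug_lagrangian_dual_step beta z x : 0 < beta ->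
  let w := dual_step f beta z x in
  aug_lagrangian g h f beta x z =
  (objective g h x + ((dot w w - dot z z) / (2 * beta))%:E)%E.
Proof.
move=> b0 /=; congr (_ + _%:E)%E; rewrite -sumrB mulr_suml.
by apply: eq_bigr => i _; rewrite psi_dual_step// !expr2.
Qed.

Lemma inexact_primal_step_le beta eps z x xs :
  0 < beta -> (forall i, 0 <= z 0 i) -> X xs -> (forall i, f i xs <= 0) ->
  inexact_primal_step X g h f beta eps z x ->
  let w := dual_step f beta z x in
  (objective g h x + ((dot w w - dot z z) / (2 * beta))%:E <=
   objective g h xs + eps%:E)%E.
Proof.
move=> b0 z_ge0 Xxs fxs [_ xmin]; rewrite /= -aug_lagrangian_dual_step//.
apply: (le_trans xmin); apply: leeD2r.
apply: (@le_trans _ _ (aug_lagrangian g h f beta xs z)).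
  by apply: ereal_inf_lbound; exists xs.
(* The penalty at the feasible point [xs] is nonpositive: a dual step taken there cannot increase
   any nonnegative multiplier. *)
rewrite aug_lagrangian_dual_step// geeDl// lee_fin.
rewrite pmulr_lle0 ?invr_gt0 ?mulr_gt0// subr_le0.
apply: ler_sum => i _; rewrite -!expr2 ler_sqr ?nnegrE ?dual_step_ge0//.
by rewrite dual_stepE// ge_max z_ge0 gerDl pmulr_rle0 ?fxs.
Qed.

Lemma le_dual_step_incr beta z x i : 0 < beta ->
  f i x <= (dual_step f beta z x 0 i - z 0 i) / beta.
Proof.
move=> b0; rewrite dual_stepE// ler_pdivlMr// lerBrDl mulrC.
by rewrite le_max lexx orbT.
Qed.

(** Where [f i x] is positive the projection is inactive, so the increment of the multiplier is
    exactly [beta * f i x]. *)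
Lemma enorm_pos_part_le beta z x : 0 < beta ->
  (forall i, 0 <= z 0 i) ->
  enorm (pos_part f x) <= enorm (dual_step f beta z x - z) / beta.
Proof.
move=> b0 z_ge0; rewrite mulrC -[X in X * _]gtr0_norm ?invr_gt0// -enormZ.
apply: le_enorm => i; rewrite [_ 0 i]mxE.
have [fi_le0|fi_gt0] := leP (f i x) 0; first by rewrite normr0.
rewrite [in leRHS]mxE [in leRHS]mxE [(- z) _ _]mxE dual_stepE//.
rewrite max_r ?addr_ge0 ?mulr_ge0 ?(ltW b0) ?(ltW fi_gt0)//.
by rewrite addrAC subrr add0r mulKf ?gt_eqF.
Qed.

Lemma sum_mul_constraints_le beta z w x : 0 < beta -> (forall i, 0 <= w 0 i) ->
  \sum_i w 0 i * f i x <= dot w (dual_step f beta z x - z) / beta.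
Proof.
move=> b0 w_ge0; rewrite mulr_suml; apply: ler_sum => i _.
have := ler_wpM2l (w_ge0 i) (le_dual_step_incr z x i b0).
by rewrite mulrA [(_ - z) 0 i]mxE [(- z) 0 i]mxE.
Qed.

(* The dual step is an inexact proximal step on the dual function, so it is
   quasi-Fejer monotone with respect to the dual solutions. *)
Lemma dual_step_dist_le beta eps z w x (F Fs : R) :
  0 < beta -> (forall i, 0 <= w 0 i) ->
  let z' := dual_step f beta z x in
  F + (dot z' z' - dot z z) / (2 * beta) <= Fs + eps ->
  Fs <= F + \sum_i w 0 i * f i x ->
  dot (z' - w) (z' - w) <= dot (z - w) (z - w) + 2 * (beta * eps).
Proof.
move=> b0 w_ge0 z' primal saddle.
have wf := sum_mul_constraints_le z x b0 w_ge0.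
have : (dot z' z' - dot z z) / (2 * beta) <= eps + dot w (z' - z) / beta by lra.
have -> : eps + dot w (z' - z) / beta =
    (2 * (beta * eps) + 2 * dot w (z' - z)) / (2 * beta).
  by field; rewrite gt_eqF.
rewrite ler_pM2r ?invr_gt0 ?mulr_gt0//.
rewrite !(dotDl, dotDr, dotNl, dotNr) !(dotC _ w); lra.
Qed.

Lemma objective_fin_num x :
  h x != -oo%E -> edom (objective g h) x -> objective g h x \is a fin_num.
Proof.
rewrite /edom /= fin_numElt => hx ->; rewrite andbT.
by rewrite /objective ltNye adde_eq_ninfty /= hx.
Qed.

End AugmentedLagrangian.

Theorem theorem8 (R : realType) (n m : nat)
  (X : set 'rV[R]_n) (g : 'rV[R]_n -> R) (h : 'rV[R]_n -> \bar R)
  (f : 'I_m -> 'rV[R]_n -> R) (L0 : R) (L : 'I_m -> R)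
  (X_closed : closed X)
  (X_convex : convex_set X)
  (g_convex : convex_function setT g)
  (g_diff : forall x, differentiable g x)
  (h_neq_ninfty : forall x, h x != -oo%E)
  (h_convex : econvex h)
  (f_convex : forall i, convex_function setT (f i))
  (f_diff : forall i x, differentiable (f i) x)
  (g_lip : lipschitz_grad_on (edom h `&` X) L0 g)
  (f_lip : forall i, lipschitz_grad_on (edom h `&` X) (L i) (f i))
  (xs : 'rV[R]_n) (zs : 'rV[R]_m)
  (xs_zs_sol : primal_dual_solution X g h f xs zs)
  (K : nat) (K_gt0 : (0 < K)%N)
  (C : R) (C_ge0 : 0 <= C)
  (beta eps : nat -> R)
  (beta_gt0 : forall k, (k < K)%N -> 0 < beta k)
  (eps_gt0 : forall k, (k < K)%N -> 0 < eps k)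
  (beta_eps_sum : \sum_(0 <= k < K) beta k * eps k <= C / 2)
  (x : nat -> 'rV[R]_n) (z : nat -> 'rV[R]_m)
  (z_init : z 0%N = 0)
  (x_step : forall k, (k < K)%N ->
    inexact_primal_step X g h f (beta k) (eps k) (z k) (x k.+1))
  (z_step : forall k, (k < K)%N ->
    z k.+1 = dual_step f (beta k) (z k) (x k.+1)) :
  forall k, (k < K)%N ->
    (`| objective g h (x k.+1) - objective g h xs | <=
       (eps k + (2 * enorm zs + Num.sqrt C) / beta k *
          (5 * enorm zs + 7 / 2 * Num.sqrt C))%R%:E)%E
    /\ enorm (pos_part f (x k.+1)) <=
       (beta k)^-1 * (5 * enorm zs + 7 / 2 * Num.sqrt C).
Proof.
have [[s [v [[xs_dom _] _ _]]] Xxs zs_ge0 fxs _] := xs_zs_sol.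
have xs_fin : objective g h xs \is a fin_num by exact: objective_fin_num.
pose Fs := fine (objective g h xs).
pose P := enorm zs; pose S := Num.sqrt C.
have P0 : 0 <= P by exact: enorm_ge0.
have S0 : 0 <= S by exact: sqrtr_ge0.
have S2 : S ^+ 2 = C by rewrite sqr_sqrtr.
have z_ge0 k : (k <= K)%N -> forall i, 0 <= z k 0 i.
  case: k => [_ i|k kK i]; first by rewrite z_init mxE.
  by rewrite z_step// dual_step_ge0// beta_gt0.
have step k : (k < K)%N -> exists F : R, [/\ objective g h (x k.+1) = F%:E,
    F + (dot (z k.+1) (z k.+1) - dot (z k) (z k)) / (2 * beta k) <= Fs + eps k &
    Fs <= F + \sum_i zs 0 i * f i (x k.+1)].
  move=> kK; have b0 := beta_gt0 _ kK.
  have := inexact_primal_step_le b0 (z_ge0 _ (ltnW kK)) Xxs fxs (x_step _ kK).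
  rewrite /= -z_step// -(fineK xs_fin) => primal.
  (* The right-hand side of [primal] is finite, which excludes the value [+oo]; from here on both
     inequalities live in the reals. *)
  have x_fin : objective g h (x k.+1) \is a fin_num.
    apply: objective_fin_num => //.
    rewrite /edom /=; move: primal; case: (objective g h (x k.+1)) => [r||]//.
    by rewrite ltry.
  have [Xx _] := x_step _ kK.
  have := primal_dual_solution_saddle f_convex f_diff xs_zs_sol Xx.
  exists (fine (objective g h (x k.+1))); split; first by rewrite fineK.
    by move: primal; rewrite -(fineK x_fin) -!EFinD lee_fin.
  by rewrite -lee_fin EFinD !fineK.
(* Iterate [dual_step_dist_le] from [z 0 = 0], whose distance to [zs] is [P]. *)
have dist2 k : (k <= K)%N -> dot (z k - zs) (z k - zs) <=
    P ^+ 2 + 2 * \sum_(0 <= j < k) beta j * eps j.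
  elim: k => [_|k IH kK].
    by rewrite z_init sub0r dotNl dotNr opprK big_geq// mulr0 addr0 sqr_enorm.
  have [F [_ primal saddle]] := step _ kK.
  rewrite z_step// in primal.
  have := dual_step_dist_le (beta_gt0 _ kK) zs_ge0 primal saddle.
  rewrite -z_step// big_nat_recr//= mulrDr; have := IH (ltnW kK); lra.
(* The partial sums stay below [C / 2], their terms being positive, and
   [P ^+ 2 + C <= (P + S) ^+ 2]. *)
have dist k : (k <= K)%N -> enorm (z k - zs) <= P + S.
  move=> kK; rewrite -ler_sqr ?nnegrE ?addr_ge0 ?enorm_ge0// sqr_enorm sqrrD S2.
  apply: (le_trans (dist2 k kK)).
  have : \sum_(0 <= j < k) beta j * eps j <= C / 2.
    apply: le_trans beta_eps_sum.
    rewrite [leRHS](big_cat_nat (n := k))//= lerDl big_nat_cond sumr_ge0// => j.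
    by rewrite andbT => /andP[_ jK]; rewrite mulr_ge0 ?ltW ?beta_gt0 ?eps_gt0.
  have := mulr_ge0 P0 S0; lra.
have znorm k : (k <= K)%N -> enorm (z k) <= 2 * P + S.
  move=> kK; have := enormD (z k - zs) zs; rewrite subrK.
  have := dist _ kK; rewrite -/P; lra.
have incr k : (k < K)%N -> enorm (z k.+1 - z k) <= 2 * P + 2 * S.
  move=> kK; rewrite -(subrKA zs) -(opprB (z k)).
  have := enormD (z k.+1 - zs) (- (z k - zs)); rewrite enormN.
  have := dist _ kK; have := dist _ (ltnW kK); lra.
move=> k kK; have b0 := beta_gt0 _ kK; have PS0 := mulr_ge0 P0 S0.
(* With [PS0], these signs let [lra] compare quadratic forms in [P] and [S] monomial by monomial. *)
have P20 := sqr_ge0 P; have S20 := sqr_ge0 S.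
have wz := incr _ kK.
split; last first.
  apply: (le_trans (enorm_pos_part_le f (x k.+1) b0 (z_ge0 _ (ltnW kK)))).
  rewrite -z_step// mulrC ler_pM2l ?invr_gt0//; rewrite -/P -/S; lra.
have [F [-> primal saddle]] := step _ kK.
rewrite -(fineK xs_fin) -/Fs -EFinB lee_fin -/P -/S ler_distl.
have rhsE : (2 * P + S) / beta k * (5 * P + 7 / 2 * S) =
  (2 * P + S) * (5 * P + 7 / 2 * S) / beta k by rewrite mulrAC.
rewrite {}rhsE; apply/andP; split.
  (* Lower bound on [F], from [saddle]: Cauchy-Schwarz bounds the inner product by
     [P * (2 * P + 2 * S)], which the stated product dominates. *)
  have := sum_mul_constraints_le f (z k) (x k.+1) b0 zs_ge0; rewrite -z_step//.
  have : dot zs (z k.+1 - z k) / beta k <=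
      (2 * P + S) * (5 * P + 7 / 2 * S) / beta k.
    rewrite ler_pM2r ?invr_gt0//.
    apply: le_trans (dot_le_enorm _ _) _; rewrite -/P.
    have := ler_wpM2l P0 wz; lra.
  have := eps_gt0 _ kK; lra.
(* Upper bound on [F]: drop the square of [z k.+1] and bound that of [z k] by [(2 * P + S) ^+ 2],
   half of which is below the stated product. *)
have primal' : F <= Fs + eps k +
    (dot (z k) (z k) - dot (z k.+1) (z k.+1)) / (2 * beta k).
  by rewrite -lerBlDr -mulNr opprB.
rewrite addrA; apply: (le_trans primal'); rewrite lerD2l.
rewrite invfM mulrA ler_pM2r ?invr_gt0//.
have zk2 : dot (z k) (z k) <= (2 * P + S) ^+ 2.
  rewrite -sqr_enorm ler_sqr ?nnegrE ?enorm_ge0 ?addr_ge0 ?mulr_ge0//.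
  exact: znorm (ltnW kK).
move: (dot_ge0 (z k.+1)) zk2 => {primal primal' saddle wz}; lra.
Qed.
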